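(* Let $d\in(0,1)$, $\alpha>-d$, and let $n\ge 1$ be an integer. Let $v_1,v_2,\ldots$ be independent random variables with $v_i\sim\mathrm{Beta}(1-d,\alpha+id)$ for $i=1,2,\ldots$, and set $\pi_j=v_j\prod_{i=1}^{j-1}(1-v_i)$ for $j=1,2,\ldots$. Let $z_1,\ldots,z_n$ be random variables with values in $\{1,2,\ldots\}$ that, conditionally on $\pi=(\pi_j)_{j\ge1}$, are independent and identically distributed with $\mathbb{P}(z_i=j\mid\pi)=\pi_j$ for all $j\ge 1$. Let $\mathbf{C}$ be the random partition of $[n]$ induced by $z_1,\ldots,z_n$. Then for every partition $C$ of $[n]$, $$\mathbb{P}(\mathbf{C}=C)=\frac{d^{|C|}}{(\alpha)_{(n)}}\Big(\frac{\alpha}{d}\Big)_{(|C|)}\prod_{c\in C}(1-d)_{(|c|-1)},$$ where, if $\alpha=0$, the ratio $d^{|C|}(\alpha/d)_{(|C|)}/(\alpha)_{(n)}$ is understood after cancelling the common factor $\alpha$ from numerator and denominator, i.e. as $\prod_{i=1}^{|C|-1}(\alpha+id)\big/\prod_{i=1}^{n-1}(\alpha+i)$.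
   Context: $[n]=\{1,\ldots,n\}$. The partition of $[n]$ induced by $z_1,\ldots,z_n$ is the partition into nonempty blocks in which $i$ and $i'$ are in the same block if and only if $z_i=z_{i'}$. For a partition $C$ of $[n]$ (a set of disjoint nonempty subsets with union $[n]$), $|C|$ is the number of blocks, and $|c|$ is the cardinality of a block $c\in C$. The rising factorial is $(x)_{(m)}=\prod_{j=0}^{m-1}(x+j)$, with $(x)_{(0)}=1$. *)

(* Defs.v *)
From mathcomp Require Import all_boot all_order all_algebra finmap.
From mathcomp Require Import all_classical all_reals all_analysis.

Set Implicit Arguments.
Unset Strict Implicit.
Unset Printing Implicit Defensive.

Import Order.TTheory GRing.Theory Num.Theory.
Import numFieldNormedType.Exports.

Local Open Scope classical_set_scope.
Local Open Scope ring_scope.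

Definition rising_factorial (R : pzRingType) (x : R) (m : nat) : R :=
  \prod_(j < m) (x + j%:R).

(* The library's [beta_prob] only has natural parameters. *)
Section real_beta.
Context {R : realType}.

Definition beta_kernel (a b x : R) : R := x `^ (a - 1) * (1 - x) `^ (b - 1).

Definition beta_integral (a b : R) : R :=
  Rintegral lebesgue_measure `]0, 1[ (beta_kernel a b).

Definition beta_density (a b x : R) : R :=
  if 0 < x < 1 then beta_kernel a b x / beta_integral a b else 0.

Definition beta_law (a b : R) (A : set R) : \bar R :=
  (\int[lebesgue_measure]_(x in A) (beta_density a b x)%:E)%E.

End real_beta.

Section independence.
Context {R : realType} {d d'} {T : measurableType d} {T' : measurableType d'}.
Variable P : probability T R.

Definition mutually_independent (I : choiceType) (D : set I)
    (X : I -> {RV P >-> T'}) : Prop :=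
  forall J : {fset I}, [set` J] `<=` D ->
  forall B : I -> set T', (forall i, measurable (B i)) ->
  P (\bigcap_(i in [set` J]) X i @^-1` B i) =
  (\prod_(i <- J) P (X i @^-1` B i))%E.

(* f is a version of the conditional probability of E given the
   sub-sigma-algebra G. *)
Definition cond_prob (G : set (set T)) (E : set T) (f : T -> R) : Prop :=
  [/\ forall B : set R, measurable B -> G (f @^-1` B),
      P.-integrable setT (EFin \o f) &
      forall A, G A -> (\int[P]_(w in A) (f w)%:E)%E = P (A `&` E)].

(* Proper subfamilies are covered by taking B i = setT. *)
Definition cond_independent (n : nat) (G : set (set T))
    (X : 'I_n -> {RV P >-> T'}) : Prop :=
  forall (B : 'I_n -> set T') (f : 'I_n -> T -> R),
  (forall i, measurable (B i)) ->
  (forall i, cond_prob G (X i @^-1` B i) (f i)) ->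
  cond_prob G (\bigcap_i X i @^-1` B i) (fun w => \prod_i f i w).

End independence.

(* Sequences are indexed from 1; the value at index 0 is never used. *)
Definition stick_breaking (R : realType) (T : Type) (v : nat -> T -> R)
    (j : nat) (w : T) : R :=
  v j w * \prod_(1 <= i < j) (1 - v i w).

Definition sigma_seq (R : realType) (T : Type) (pi : nat -> T -> R) :
    set (set T) :=
  <<s \bigcup_(j in [set j | (1 <= j)%N])
        preimage_set_system setT (pi j) measurable >>.

Definition induced_partition (n : nat) (z : 'I_n -> nat) : {set {set 'I_n}} :=
  preim_partition z [set: 'I_n]%SET.

(* Main.v *)
(* For a set [D] of blocks with sizes [s c], let [S_k D] be the sum, over the
   injective labellings of [D] by labels greater than [k], of the expected product
   of the [(pi_j)^(s c)], where the first [k] sticks are not broken off.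
   According to whether the label [k + 1] is unused or used by a block [c],
   independence of the [v_j] and the Beta moments give a linear recursion
   expressing [S_k D] through [S_(k+1) D] and the
   [S_(k+1) (D :\ c)].  The closed form with [alpha] replaced by [alpha + k d]
   satisfies the same recursion exactly, since
   [(alpha + k d + #|D| d) + \sum_(c in D) (s c - d) = alpha + k d + N] with
   [N = \sum_(c in D) s c].  Truncating the labels at [M], the relative error
   contracts at level [j] by a factor [1 - (1 - d) / (alpha + j d + n)], and the
   product of these factors tends to [0]. *)

Require Import Defs.
From mathcomp Require Import all_boot all_order all_algebra finmap.
From mathcomp Require Import all_classical all_reals all_analysis.
From mathcomp Require Import measurable_realfun ring lra.

Set Implicit Arguments.
Unset Strict Implicit.
Unset Printing Implicit Defensive.

Import Order.TTheory GRing.Theory Num.Theory.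
Import numFieldNormedType.Exports.

Local Open Scope classical_set_scope.
Local Open Scope ring_scope.

(** * Change of density and expectations of independent products *)

Section density.
Local Open Scope ereal_scope.
Import HBNNSimple.
Context {R : realType} {d d'} {T : measurableType d} {U : measurableType d'}.
Variables (mu : {measure set T -> \bar R}) (nu : {measure set U -> \bar R}).
Variables (X : T -> U) (h : T -> R).
Hypothesis mX : measurable_fun setT X.
Hypothesis mh : measurable_fun setT h.
Let mEh : measurable_fun setT (EFin \o h).
Proof. exact/measurable_EFinP. Qed.
Hypothesis h0 : forall x, (0 <= h x)%R.
Hypothesis nuE : forall B, measurable B ->
  nu B = \int[mu]_(x in X @^-1` B) (h x)%:E.

(** For indicators this is the hypothesis [nuE]. It passes to simple functions by linearity and to
    [g] by monotone convergence of the approximations [g_ n] on both sides. *)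
Lemma ge0_integral_density (g : U -> \bar R) :
  measurable_fun setT g -> (forall y, 0 <= g y) ->
  \int[nu]_y g y = \int[mu]_x (g (X x) * (h x)%:E).
Proof.
move=> mg g0; pose g_ := nnsfun_approx measurableT mg.
have gE y : limn (fun n => (g_ n y)%:E) = g y.
  by apply/cvg_lim => //; exact: (cvg_nnsfun_approx _ mg).
have nd y m n : (m <= n)%N -> (g_ m y)%:E <= (g_ n y)%:E.
  by move=> mn; rewrite lee_fin; exact/lefP/nd_nnsfun_approx.
have mgX n : measurable_fun setT (fun x => (g_ n (X x))%:E).
  by apply/measurable_EFinP; exact: measurableT_comp.
have mi n k : measurable_fun setT
    (fun x => (\1_(g_ n @^-1` [set k]) (X x) : R)%:E).
  apply/measurable_EFinP.
  have m1 : measurable_fun setT (\1_(g_ n @^-1` [set k]) : U -> R) by [].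
  exact: (measurableT_comp m1 mX).
transitivity (limn (fun n => \int[nu]_y (g_ n y)%:E)).
  rewrite -monotone_convergence//.
  - by apply: eq_integral => y _; rewrite gE.
  - by move=> n; exact/measurable_EFinP.
  - by move=> n y _; rewrite lee_fin.
  - by move=> y _ m n; exact: nd.
transitivity (limn (fun n => \int[mu]_x ((g_ n (X x))%:E * (h x)%:E))); last first.
  rewrite -monotone_convergence//.
  - apply: eq_integral => x _; apply/cvg_lim => //.
    by apply: cvgeZr => //; exact: (cvg_nnsfun_approx _ mg).
  - by move=> n; apply: emeasurable_funM.
  - by move=> n x _; rewrite mule_ge0// lee_fin.
  - by move=> x _ m n mn; apply: lee_wpmul2r; rewrite ?lee_fin//; exact/lefP/nd_nnsfun_approx.
congr (limn _); apply/funext => n.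
rewrite integralT_nnsfun sintegralE.
transitivity (\sum_(k \in range (g_ n))
    \int[mu]_x (k%:E * ((\1_(g_ n @^-1` [set k]) (X x))%:E * (h x)%:E))); last first.
  rewrite -ge0_integral_fsum//.
  - apply: eq_integral => x _.
    under eq_fsbigr do rewrite muleA -EFinM.
    rewrite fsumEFin//.
    rewrite -EFinM [in RHS]fimfunE; congr EFin.
    by rewrite mulr_fsuml.
  - by move=> k; apply: measurable_funeM; apply: emeasurable_funM.
  - by move=> k x _; rewrite muleA mule_ge0 ?lee_fin//;
      exact: (nnfun_muleindic_ge0 (g_ n) k (X x)).
apply: eq_fsbigr => k; rewrite inE => -[y _ <-].
rewrite ge0_integralZl//; last 3 first.
- by apply: emeasurable_funM.
- by move=> x _; rewrite mule_ge0// lee_fin.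
- by rewrite lee_fin.
congr (_ * _); rewrite nuE// integral_mkcond; apply: eq_integral => x _.
rewrite patchE indicE.
have -> : (x \in X @^-1` (g_ n @^-1` [set g_ n y])) =
  (X x \in g_ n @^-1` [set g_ n y]) by [].
by case: ifPn; rewrite ?mul1e ?mul0e.
Qed.

End density.

Section product_expectation.
Local Open Scope ereal_scope.
Context {R : realType} {d d'} {T : measurableType d} {T' : measurableType d'}.
Variables (P : probability T R) (I : choiceType) (D : set I).
Variable X : I -> {RV P >-> T'}.
Hypothesis indX : mutually_independent D X.

(** Independence is the case where every factor is an indicator. The indicators are then replaced by
    the [g i] one index at a time, each replacement being a change of density. Finite expectations
    keep the product of the other factors' integrals a real number, by which a law can be scaled. *)
Lemma ge0_expectation_prod (J : {fset I}) (g : I -> T' -> R) :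
  [set` J] `<=` D ->
  (forall i, measurable_fun setT (g i)) -> (forall i y, (0 <= g i y)%R) ->
  (forall i, \int[P]_w (g i (X i w))%:E \is a fin_num) ->
  \int[P]_w (\prod_(i <- J) g i (X i w))%:E =
  \prod_(i <- J) \int[P]_w (g i (X i w))%:E.
Proof.
move=> JD mg g0 gfin.
(* The indices in [s] already carry [g i], the others an indicator. The induction on [s] keeps [B]
   arbitrary, so that the set at the next index may be chosen freely. *)
pose f (s : seq I) B i := if i \in s then g i else \1_(B i).
have mf s B i : (forall i, measurable (B i)) -> measurable_fun setT (f s B i).
  by rewrite /f; case: ifPn.
have f0 s B i y : (0 <= f s B i y)%R by rewrite /f; case: ifPn.
have mfX s B i : (forall i, measurable (B i)) ->
    measurable_fun setT (fun w => f s B i (X i w)).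
  by move=> mB; apply: measurableT_comp => //; exact: mf.
have indE B i : measurable B ->
    \int[P]_w (\1_B (X i w))%:E = P (X i @^-1` B).
  move=> mB; rewrite -[X in P X]setIT -integral_indic//.
  by rewrite -[X in measurable X]setTI; exact: measurable_funPT.
suff fE s B : (forall i, measurable (B i)) ->
    \int[P]_w (\prod_(i <- J) f s B i (X i w))%:E =
    \prod_(i <- J) \int[P]_w (f s B i (X i w))%:E.
  have := fE (enum_fset J) (fun=> setT) (fun=> measurableT).
  under eq_integral do under eq_big_seq => i iJ do rewrite /f iJ.
  by under [RHS]eq_big_seq => i iJ do rewrite /f iJ.
elim: s B => [|k s IH] B mB.
  rewrite /f; under [RHS]eq_bigr do rewrite /= indE//.
  rewrite -indX//.
  have mXB : measurable (\bigcap_(i in [set` J]) X i @^-1` B i).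
    apply: fin_bigcap_measurable => // i _.
    by rewrite -[X in measurable X]setTI; exact: measurable_funPT.
  rewrite -[\bigcap_(i in _) _]setIT -integral_indic//; apply: eq_integral => w _; congr EFin.
  rewrite [RHS]indicE; case: (boolP (w \in _)) => [|]; last first.
    rewrite notin_setE => nw; apply/eqP; rewrite prodf_seq_eq0.
    apply/hasP; apply: contrapT => H; apply: nw => i /= iJ.
    apply: contrapT => nB; apply: H; exists i => //=.
    by rewrite indicE memNset.
  rewrite inE => wB; rewrite big1_seq// => i /= iJ.
  by rewrite indicE mem_set//; exact: wB.
have [kJ|kJ] := boolP (k \in J); last first.
  have E i : i \in J -> f (k :: s) B i = f s B i.
    by move=> iJ; rewrite /f inE; case: eqVneq => // ik; rewrite -ik iJ in kJ.
  under eq_integral do under eq_big_seq => i iJ do rewrite E//.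
  under [RHS]eq_big_seq => i iJ do rewrite E//.
  exact: IH.
have [ks|ks] := boolP (k \in s).
  have E i : f (k :: s) B i = f s B i.
    by rewrite /f inE; case: eqVneq => // ->; rewrite ks.
  under eq_integral do under eq_bigr do rewrite E.
  under [RHS]eq_bigr do rewrite E.
  exact: IH.
pose h w := (\prod_(i <- (J `\ k)%fset) f s B i (X i w))%R.
pose c := \prod_(i <- (J `\ k)%fset) \int[P]_w (f s B i (X i w))%:E.
have c0 : 0 <= c.
  by apply: prode_ge0 => i _; apply: integral_ge0 => w _; rewrite lee_fin.
have cfin : c \is a fin_num.
  rewrite /c; apply: prode_fin_num => i _; rewrite /f; case: ifPn => // _.
  rewrite indE//; apply: fin_num_measure => //.
  by rewrite -[X in measurable X]setTI; exact: measurable_funPT.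
have fJk i : i \in (J `\ k)%fset -> f (k :: s) B i = f s B i.
  by rewrite !inE => /andP[/negbTE ik _]; rewrite /f inE ik.
have mh : measurable_fun setT h by apply: measurable_prod => i _; exact: mfX.
have h0 w : (0 <= h w)%R by apply: prodr_ge0.
have c0' : (0 <= fine c)%R by exact: fine_ge0.
(* The product [h] of the other factors acts as a density along [X k]. The induction hypothesis,
   with the set at [k] taken to be [C], says that the measure so obtained is [c] times the law of
   [X k]. *)
have nuE C : measurable C -> mscale (NngNum c0') (distribution P (X k)) C =
    \int[P]_(w in X k @^-1` C) (h w)%:E.
  move=> mC.
  pose B' i := if i == k then C else B i.
  have mB' i : measurable (B' i) by rewrite /B'; case: ifPn.
  have := IH B' mB'; rewrite (big_fsetD1 k)//=.
  have E i : i \in (J `\ k)%fset -> f s B' i = f s B i.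
    by rewrite !inE => /andP[/negbTE ik _]; rewrite /f /B' ik.
  under [in RHS]eq_big_seq => i iJ do rewrite E//.
  rewrite -/c {2}/f (negbTE ks) /B' eqxx indE// => H.
  rewrite /mscale/= fineK// muleC -[LHS]H [RHS]integral_mkcond.
  apply: eq_integral => w _; rewrite (big_fsetD1 k)//=.
  under eq_big_seq => i iJ do rewrite E//.
  rewrite -/(h w) /f (negbTE ks) eqxx indicE patchE.
  have -> : (w \in X k @^-1` C) = (X k w \in C) by [].
  by case: ifPn; rewrite ?mul1r ?mul0r.
have mgk : measurable_fun setT (EFin \o g k) by exact/measurable_EFinP.
have gk0 y : 0 <= (EFin \o g k) y by rewrite lee_fin.
have := ge0_integral_density (measurable_funPT (X k)) mh h0 nuE mgk gk0.
rewrite ge0_integral_mscale//.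
rewrite [_%:num]/= fineK// ge0_integral_distribution//= => H.
rewrite (big_fsetD1 k)//= [X in _ * X](_ : _ = c); last first.
  by apply: eq_big_seq => i iJ; rewrite fJk.
rewrite {2}/f mem_head muleC H; apply: eq_integral => w _.
rewrite (big_fsetD1 k)//= EFinM {1}/f mem_head; congr (_ * _%:E).
by apply: eq_big_seq => i iJ; rewrite fJk.
Qed.

End product_expectation.

(** * Moments of Beta variables *)

Section beta_moments.
Context {R : realType}.
Implicit Types a b p q x : R.
Local Notation mu := (@lebesgue_measure R).
Local Notation I01 := (`]0, 1[%classic : set R).

Lemma beta_kernel_ge0 p q x : 0 <= beta_kernel p q x.
Proof. by rewrite mulr_ge0// powR_ge0. Qed.

Lemma measurable_beta_kernel p q : measurable_fun setT (beta_kernel p q).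
Proof.
apply: measurable_funM; first exact: measurable_powR.
apply: (@measurableT_comp _ _ _ _ _ _ (fun y : R => y `^ (q - 1))).
  exact: measurable_powR.
exact: measurable_funB.
Qed.

Lemma beta_kernelD p q (m k : nat) x : 0 < x < 1 ->
  beta_kernel (p + m%:R) (q + k%:R) x =
  x ^+ m * (1 - x) ^+ k * beta_kernel p q x.
Proof.
move=> /andP[x0 x1]; have y0 : 0 < 1 - x by rewrite subr_gt0.
rewrite /beta_kernel [p + _ - 1]addrAC [q + _ - 1]addrAC.
have E (y r : R) n : 0 < y -> y `^ (r + n%:R) = y `^ r * y ^+ n.
  by move=> y1; rewrite powRD ?(gt_eqF y1) ?implybT// powR_mulrn// ltW.
by rewrite !E//; ring.
Qed.

Definition beta_integrable p q := mu.-integrable I01 (EFin \o beta_kernel p q).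

Lemma beta_integralE p q : beta_integrable p q ->
  (beta_integral p q)%:E = (\int[mu]_(x in I01) (beta_kernel p q x)%:E)%E.
Proof. by move=> H; rewrite fineK//; exact: integrable_fin_num. Qed.

(** A divergent integral of the nonnegative kernel would be sent to 0 by [fine]. A nonzero value
    thus certifies convergence, with no estimate of the kernel near 0 and 1. *)
Lemma beta_integrable_neq0 p q : beta_integral p q != 0 -> beta_integrable p q.
Proof.
move=> B0; apply/integrableP; split.
  by apply/measurable_EFinP/measurable_funTS; exact: measurable_beta_kernel.
under eq_integral do rewrite /= ger0_norm ?beta_kernel_ge0//.
move: B0; rewrite /beta_integral /Rintegral.
have : (0 <= \int[mu]_(x in I01) (beta_kernel p q x)%:E)%E.
  by apply: integral_ge0 => x _; rewrite lee_fin beta_kernel_ge0.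
by case: (\int[mu]_(x in I01) _)%E => /= [r _ _|_|//]; [rewrite ltry|rewrite eqxx].
Qed.

Lemma beta_integrableD p q (m k : nat) :
  beta_integrable p q -> beta_integrable (p + m%:R) (q + k%:R).
Proof.
move=> H; apply: le_integrable H => //=.
  by apply/measurable_EFinP/measurable_funTS; exact: measurable_beta_kernel.
move=> x; rewrite in_itv/= => x01; rewrite lee_fin.
rewrite !ger0_norm ?beta_kernel_ge0// beta_kernelD// ler_piMl ?beta_kernel_ge0//.
case/andP: x01 => /ltW x0 /ltW x1.
by rewrite mulr_ile1 ?exprn_ge0 ?exprn_ile1 ?subr_ge0// gerBl.
Qed.

(** This integrates [x + (1 - x) = 1] against the kernel. *)
Lemma beta_integral_split p q : beta_integrable p q ->
  beta_integral p q = beta_integral (p + 1) q + beta_integral p (q + 1).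
Proof.
move=> H.
have H1 : beta_integrable (p + 1) q.
  by have := @beta_integrableD p q 1 0 H; rewrite addr0.
have H2 : beta_integrable p (q + 1).
  by have := @beta_integrableD p q 0 1 H; rewrite addr0.
apply: EFin_inj; rewrite EFinD !beta_integralE// -integralD//.
apply: eq_integral => x; rewrite inE/= in_itv/= => x01.
have := @beta_kernelD p q 1 0 x x01; rewrite addr0 => ->.
have := @beta_kernelD p q 0 1 x x01; rewrite addr0 => ->.
by rewrite -EFinD; congr EFin; ring.
Qed.

Lemma is_derive_beta_kernel p q x : 0 < x < 1 ->
  is_derive x 1 (beta_kernel (p + 1) (q + 1))
    (p * beta_kernel p (q + 1) x - q * beta_kernel (p + 1) q x).
Proof.
move=> /andP[x0 x1]; have y0 : 0 < 1 - x by rewrite subr_gt0.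
rewrite /beta_kernel !addrK.
have d1 := is_derive1_powR p x0.
have d2 : is_derive x 1 (fun y => (1 - y) `^ q) (q * (1 - x) `^ (q - 1) * -1).
  have d0 : is_derive x 1 (fun y : R => 1 - y) (-1).
    by apply: is_derive_eq; rewrite add0r mul1r.
  have := (@is_derive1_comp _ (fun y => y `^ q) (fun y => 1 - y) _ _ _
    (is_derive1_powR q y0) d0).
  exact.
apply: (is_derive_eq (is_deriveM d1 d2)).
rewrite /GRing.scale/=; ring.
Qed.

Let cvg_inv3 : (n.+3%:R^-1 : R) @[n --> \oo] --> (0 : R).
Proof.
have := @cvg_harmonic R; rewrite -(cvg_shiftn 2) => h.
by apply: cvg_trans h; apply: near_eq_cvg; apply: nearW => n /=; rewrite addn2.
Qed.

Lemma beta_kernel_endpoints p q : 0 < p -> 0 < q ->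
  (fun n => beta_kernel (p + 1) (q + 1) (1 - n.+3%:R^-1) -
            beta_kernel (p + 1) (q + 1) n.+3%:R^-1) @ \oo --> (0 : R).
Proof.
have e01 n : 0 < (n.+3%:R^-1 : R) < 1.
  by rewrite invr_gt0 ltr0n invf_lt1 ?ltr0n// ltr1n.
(* Reflecting [x] to [1 - x] swaps the two parameters, so the left endpoint suffices. *)
suff H p' q' : 0 < p' -> 0 < q' ->
    (fun n => beta_kernel (p' + 1) (q' + 1) n.+3%:R^-1) @ \oo --> (0 : R).
  move=> p0 q0; rewrite -[X in _ --> X](subr0 0); apply: cvgB; last exact: H.
  apply: cvg_trans (H q p q0 p0); apply: near_eq_cvg; near=> n.
  by rewrite /beta_kernel subKr mulrC.
move=> p0 q0.
have h : ((n.+3%:R^-1 : R) `^ p') @[n --> \oo] --> (0 : R).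
  have /cvg_at_rightP := powR_cvg0 p0; apply; split.
    by move=> n; case/andP: (e01 n).
  exact: cvg_inv3.
apply: (squeeze_cvgr _ (cvg_cst 0) h); near=> n.
rewrite beta_kernel_ge0/= /beta_kernel !addrK ler_piMr ?powR_ge0//.
case/andP: (e01 n) => e0 e1.
by rewrite -[leRHS](powRr0 (1 - n.+3%:R^-1)) ger_powR ?subr_gt0 ?e1 ?gerBl ?ltW.
Unshelve. all: by end_near. Qed.

(** The derivative of [x^p (1 - x)^q] has integral 0 over the unit interval, the boundary values
    being 0. As this derivative may be unbounded at 0 and 1, the fundamental theorem is applied on
    compact subintervals, and dominated convergence gives the limit. *)
Lemma beta_integral_parts p q : 0 < p -> 0 < q ->
  beta_integrable p (q + 1) -> beta_integrable (p + 1) q ->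
  p * beta_integral p (q + 1) = q * beta_integral (p + 1) q.
Proof.
move=> p0 q0 H1 H2; set F := beta_kernel (p + 1) (q + 1).
pose f x := p * beta_kernel p (q + 1) x - q * beta_kernel (p + 1) q x.
have e01 n : 0 < (n.+3%:R^-1 : R) < 1.
  by rewrite invr_gt0 ltr0n invf_lt1 ?ltr0n// ltr1n.
(* The offset 3 makes the left end smaller than [2^-1], so every interval is nondegenerate. *)
pose D n := `[n.+3%:R^-1, 1 - n.+3%:R^-1]%classic : set R.
have D01 n x : D n x -> 0 < x < 1.
  rewrite /D/= in_itv/= => /andP[x1 x2]; case/andP: (e01 n) => e0 e1.
  by rewrite (lt_le_trans e0 x1)/= (le_lt_trans x2)// gtrBl.
have FTC n : (\int[mu]_(x in D n) (f x)%:E =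
    (F (1 - n.+3%:R^-1) - F n.+3%:R^-1)%:E)%E.
  have ab : (n.+3%:R^-1 : R) < 1 - n.+3%:R^-1.
    have : (n.+3%:R^-1 : R) < 2^-1.
      by rewrite ltf_pV2 ?posrE ?ltr0n// ltr_nat.
    move: (n.+3%:R^-1) => e; lra.
  have dF x : D n x -> is_derive x 1 F (f x).
    by move=> /D01; exact: is_derive_beta_kernel.
  have oc x : x \in `]n.+3%:R^-1, (1 - n.+3%:R^-1)[ -> D n x.
    exact: subset_itv_oo_cc.
  have cF : {within D n, continuous F}.
    apply: derivable_within_continuous => x xD.
    by have [] := dF x xD.
  rewrite (@continuous_FTC2 _ f F) ?EFinB//.
  - apply: derivable_within_continuous => x xD.
    have x01 := D01 n x xD; have /andP[x0 x1] := x01.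
    apply: derivableB; apply: derivableM => //.
    + by have [] := is_derive_beta_kernel (p - 1) q x01; rewrite subrK.
    + by have [] := is_derive_beta_kernel p (q - 1) x01; rewrite subrK.
  - have /continuous_within_itvP := cF; move=> /(_ ab)[_ c1 c2].
    by split => // x /oc /dF[].
  - by move=> x /oc /dF[_ <-]; rewrite derive1E.
have mf : measurable_fun setT f.
  by apply: measurable_funB; apply: measurable_funM => //;
    exact: measurable_beta_kernel.
have int_f : mu.-integrable I01 (EFin \o f).
  apply: eq_integrable (integrableB _ (integrableZl _ p H1) (integrableZl _ q H2)) => //.
have cf : (fun n => \int[mu]_(x in I01) ((f \_ (D n)) x)%:E)%E @ \oo -->
    (\int[mu]_(x in I01) (f x)%:E)%E.
  apply: (@dominated_cvg _ _ _ mu _ _ _ _ (fun x => `|f x|%:E)) => //.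
  - move=> n; apply/measurable_EFinP/measurable_funTS.
    apply/(measurable_restrictT f); first exact: measurable_itv.
    exact: measurable_funTS mf.
  - move=> x /=; rewrite in_itv/= => /andP[x0 x1].
    apply: cvg_near_cst.
    have : \forall n \near \oo, (n.+3%:R^-1 : R) < Num.min x (1 - x).
      by apply: cvgr_lt cvg_inv3 _ _; rewrite lt_min x0 subr_gt0.
    apply: filterS => n; rewrite lt_min => /andP[n1 n2].
    by rewrite patchE mem_set// /D/= in_itv/= ltW//= lerBrDl -lerBrDr ltW.
  - by have := integrable_abse int_f.
  - by move=> n x _; rewrite patchE; case: ifP => _; rewrite /= lee_fin ?normr0.
have : (\int[mu]_(x in I01) (f x)%:E = 0)%E.
  apply: (cvg_unique _ cf) => //.
  rewrite [X in X @ _](_ : _ = EFin \o (fun n =>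
      F (1 - n.+3%:R^-1) - F n.+3%:R^-1)); last first.
    apply/funext => n /=; rewrite -FTC [RHS]integral_mkcond [LHS]integral_mkcond.
    apply: eq_integral => x _; rewrite !patchE.
    have [/set_mem /D01 x01|_] := boolP (x \in D n); last by case: ifP.
    by rewrite mem_set//= in_itv.
  apply: cvg_EFin; first exact: nearW.
  exact: beta_kernel_endpoints.
rewrite (_ : (\int[mu]_(x in I01) (f x)%:E)%E =
  (p * beta_integral p (q + 1) - q * beta_integral (p + 1) q)%:E).
  by case=> /eqP; rewrite subr_eq0 => /eqP.
rewrite EFinB !EFinM !beta_integralE// -!integralZl// -integralB//.
- exact: integrableZl.
- exact: integrableZl.
Qed.

End beta_moments.

Section beta_moment_formula.
Context {R : realType}.
Implicit Types p q x : R.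
Local Notation mu := (@lebesgue_measure R).
Local Notation I01 := (`]0, 1[%classic : set R).

Lemma rising_factorialS x m :
  rising_factorial x m.+1 = rising_factorial x m * (x + m%:R).
Proof. by rewrite /rising_factorial big_ord_recr. Qed.

Lemma rising_factorial_gt0 x m : 0 < x -> 0 < rising_factorial x m.
Proof. by move=> x0; apply: prodr_gt0 => i _; rewrite ltr_pwDl. Qed.

(** Splitting and integration by parts give two linear equations, [a + b = beta_integral p q] and
    [p * b = q * a], for the two raised integrals [a] and [b]. *)
Lemma beta_integralS p q : 0 < p -> 0 < q -> beta_integrable p q ->
  beta_integral (p + 1) q * (p + q) = p * beta_integral p q /\
  beta_integral p (q + 1) * (p + q) = q * beta_integral p q.
Proof.
move=> p0 q0 H.
have H1 : beta_integrable (p + 1) q.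
  by have := @beta_integrableD _ p q 1 0 H; rewrite addr0.
have H2 : beta_integrable p (q + 1).
  by have := @beta_integrableD _ p q 0 1 H; rewrite addr0.
have := beta_integral_parts p0 q0 H2 H1.
rewrite (beta_integral_split H).
set a := beta_integral (p + 1) q; set b := beta_integral p (q + 1) => E.
by split; [rewrite [RHS]mulrDr E|rewrite [RHS]mulrDr -E]; ring.
Qed.

Lemma beta_integralD p q m k : 0 < p -> 0 < q -> beta_integrable p q ->
  beta_integral (p + m%:R) (q + k%:R) * rising_factorial (p + q) (m + k) =
  rising_factorial p m * rising_factorial q k * beta_integral p q.
Proof.
move=> p0 q0 H; elim: k => [|k IH].
  rewrite addr0 addn0 [rising_factorial q 0]big_ord0 mulr1.
  elim: m => [|m IH]; first by rewrite /rising_factorial !big_ord0 addr0 mulr1 mul1r.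
  have Hm : beta_integrable (p + m%:R) q.
    by have := @beta_integrableD _ p q m 0 H; rewrite addr0.
  have [E _] := beta_integralS (ltr_wpDr (ler0n _ m) p0) q0 Hm.
  rewrite !rising_factorialS -natr1 addrA.
  transitivity (rising_factorial (p + q) m *
    (beta_integral (p + m%:R + 1) q * (p + m%:R + q))); first by ring.
  by rewrite E mulrCA [X in _ * X]mulrC IH; ring.
have Hm := @beta_integrableD _ p q m k H.
have [_ E] := beta_integralS (ltr_wpDr (ler0n _ m) p0) (ltr_wpDr (ler0n _ k) q0) Hm.
rewrite addnS !rising_factorialS -natr1 [q + _]addrA.
transitivity (rising_factorial (p + q) (m + k) *
  (beta_integral (p + m%:R) (q + k%:R + 1) * (p + m%:R + (q + k%:R)))).
  by rewrite natrD; ring.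
by rewrite E mulrCA [X in _ * X]mulrC IH; ring.
Qed.

(** The cut-off outside the unit interval makes the function nonnegative everywhere, as
    [ge0_expectation_prod] requires, and changes nothing almost surely for a Beta variable. *)
Definition unit_monomial (m k : nat) (x : R) : R :=
  if 0 < x < 1 then x ^+ m * (1 - x) ^+ k else 0.

Lemma unit_monomial_ge0 m k x : 0 <= unit_monomial m k x.
Proof.
rewrite /unit_monomial; case: ifP => // /andP[x0 x1].
by rewrite mulr_ge0// exprn_ge0// ?subr_ge0 ltW.
Qed.

Let indicI01 x : (if 0 < x < 1 then 1 else 0) = \1_I01 x :> R.
Proof.
rewrite indicE; have [x01|x01] := boolP (0 < x < 1).
  by rewrite mem_set//= in_itv.
by rewrite memNset//= in_itv; exact/negP.
Qed.

Lemma measurable_unit_monomial m k : measurable_fun setT (unit_monomial m k).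
Proof.
rewrite (_ : unit_monomial m k = fun x => x ^+ m * (1 - x) ^+ k * \1_I01 x).
  apply: measurable_funM; last exact: measurable_indic.
  by apply: measurable_funM; apply: measurable_funX => //; exact: measurable_funB.
apply/funext => x; rewrite -indicI01 /unit_monomial.
by case: ifP; rewrite ?mulr1 ?mulr0.
Qed.

Lemma measurable_beta_density p q : measurable_fun setT (beta_density p q).
Proof.
rewrite (_ : beta_density p q =
    fun x => beta_kernel p q x / beta_integral p q * \1_I01 x).
  apply: measurable_funM; last exact: measurable_indic.
  by apply: measurable_funM => //; exact: measurable_beta_kernel.
apply/funext => x; rewrite -indicI01 /beta_density.
by case: ifP; rewrite ?mulr1 ?mulr0.
Qed.

Lemma beta_integral_ge0 p q : 0 <= beta_integral p q.
Proof.
by apply: fine_ge0; apply: integral_ge0 => x _; rewrite lee_fin beta_kernel_ge0.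
Qed.

Lemma beta_density_ge0 p q x : 0 <= beta_density p q x.
Proof.
rewrite /beta_density; case: ifP => // _.
by rewrite divr_ge0 ?beta_kernel_ge0 ?beta_integral_ge0.
Qed.

Section beta_variable.
Context {disp : measure_display} {T : measurableType disp}.
Variables (P : probability T R) (X : {RV P >-> R}) (p q : R).
Hypothesis lawX : forall A : set R, measurable A ->
  distribution P X A = beta_law p q A.

(** If the normalising constant were 0, division by zero would make the density vanish, and the law
    would have total mass 0 instead of 1. *)
Lemma beta_law_integrable : beta_integral p q != 0.
Proof.
apply/eqP => B0; have := lawX measurableT.
rewrite probability_setT /beta_law integral0_eq.
  by move=> [] /eqP; rewrite oner_eq0.
by move=> x _; rewrite /beta_density B0 invr0 mulr0; case: ifP.
Qed.

Lemma beta_variable_unit : P (X @^-1` (~` I01)) = 0%E.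
Proof.
have mC : measurable (~` I01) by apply: measurableC.
have := lawX mC; rewrite /beta_law integral0_eq//.
move=> x; rewrite /= in_itv/= => /negP/negbTE x01.
by rewrite /beta_density x01.
Qed.

Lemma expectation_unit_monomial m k : 0 < p -> 0 < q ->
  (\int[P]_w (unit_monomial m k (X w))%:E)%E =
  (rising_factorial p m * rising_factorial q k /
   rising_factorial (p + q) (m + k))%:E.
Proof.
move=> p0 q0; have B0 := beta_law_integrable.
have H := beta_integrable_neq0 B0.
have mg : measurable_fun setT (EFin \o unit_monomial m k).
  by apply/measurable_EFinP; exact: measurable_unit_monomial.
have g0 x : (0 <= (EFin \o unit_monomial m k) x)%E.
  by rewrite lee_fin unit_monomial_ge0.
have := ge0_integral_distribution X mg g0 => /= <-.
rewrite (@ge0_integral_density _ _ _ _ _ mu (distribution P X) id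
  (beta_density p q))//; [|exact: measurable_beta_density|exact: beta_density_ge0].
transitivity (\int[mu]_(x in I01) ((beta_integral p q)^-1%:E *
   (beta_kernel (p + m%:R) (q + k%:R) x)%:E))%E.
  rewrite [RHS]integral_mkcond; apply: eq_integral => x _.
  rewrite patchE /= /unit_monomial /beta_density; case: ifPn => x01.
    rewrite mem_set/= ?in_itv//= beta_kernelD// -!EFinM; congr EFin; ring.
  by rewrite memNset ?mul0e//= in_itv; exact/negP.
have Hmk := @beta_integrableD _ p q m k H.
rewrite integralZl// -beta_integralE// -EFinM; congr EFin.
have r0 : rising_factorial (p + q) (m + k) != 0.
  by rewrite gt_eqF// rising_factorial_gt0// addr_gt0.
apply: (mulIf r0); rewrite -[LHS]mulrA beta_integralD// divfK//.
by rewrite mulrC mulfK.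
Qed.

End beta_variable.

End beta_moment_formula.

(** * Sums over labellings of the blocks *)

Section labelled_sums.
Local Open Scope nat_scope.
Context {R : comPzRingType} {I : finType}.
Variables (s : I -> nat) (w : nat -> nat -> nat -> R) (M : nat).
Implicit Types (D : {set I}) (g : {ffun I -> 'I_M.+1}) (c : I).

Definition total_size D := \sum_(c in D) s c.

(* The value 0, which is not a label, marks the blocks outside [D]. *)
Definition labellings (k : nat) D : pred {ffun I -> 'I_M.+1} := fun g =>
  [forall c, if c \in D then k < g c else g c == ord0] &&
  [forall c in D, forall c' in D, (g c == g c') ==> (c == c')].

(** The two arguments after [j] will be the exponents of [v_(j+1)] and [1 - v_(j+1)]: an element
    labelled [j.+1] selects that stick, and one with a larger label passes it. *)
Definition label_weight (k : nat) D g : R :=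
  (\prod_(k <= j < M) w j (\sum_(c in D | g c == j.+1 :> nat) s c)%N
                          (\sum_(c in D | j.+1 < g c) s c)%N)%R.

Definition labelled_sum k D : R :=
  (\sum_(g | labellings k D g) label_weight k D g)%R.

Lemma labellingsP k D g : reflect
  [/\ forall c, c \in D -> k < g c, forall c, c \notin D -> g c = ord0 &
      {in D &, injective g}]
  (labellings k D g).
Proof.
apply: (iffP andP) => [[/forallP H1 /forall_inP H2]|[H1 H2 H3]]; split.
- by move=> c cD; have := H1 c; rewrite cD.
- by move=> c /negbTE cD; have := H1 c; rewrite cD => /eqP.
- move=> c c' cD c'D gE; have /forall_inP/(_ c' c'D) := H2 c cD.
  by rewrite gE eqxx => /eqP.
- by apply/forallP => c; case: ifPn => [/H1//|/H2 ->].
- apply/forall_inP => c cD; apply/forall_inP => c' c'D.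
  by apply/implyP => /eqP /H3 ->.
Qed.

Lemma labelled_sum_last D : labelled_sum M D = (D == finset.set0)%:R%R.
Proof.
rewrite /labelled_sum /label_weight.
under eq_bigr do rewrite big_geq//.
have [->|/set0Pn[c cD]] := eqVneq D finset.set0; last first.
  rewrite big_pred0// => g; apply/negbTE/negP => /labellingsP[/(_ c cD)].
  by rewrite ltnNge -ltnS ltn_ord.
rewrite (big_pred1 [ffun=> ord0])// => g; apply/labellingsP/eqP => [[_ H _]|->].
  by apply/ffunP => c; rewrite ffunE H// inE.
by split=> [c|c _|c c']; rewrite ?inE// ffunE.
Qed.

Definition relabel g c (x : 'I_M.+1) : {ffun I -> 'I_M.+1} :=
  [ffun c' => if c' == c then x else g c'].

Lemma label_weightS k D g : k < M -> label_weight k D g =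
  (w k (\sum_(c in D | g c == k.+1 :> nat) s c)%N
       (\sum_(c in D | k.+1 < g c) s c)%N * label_weight k.+1 D g)%R.
Proof. by move=> kM; rewrite /label_weight big_ltn. Qed.

Lemma labelled_sum_unused k D : k < M ->
  (\sum_(g | labellings k D g && [forall c in D, g c != k.+1 :> nat])
     label_weight k D g = w k 0 (total_size D) * labelled_sum k.+1 D)%R.
Proof.
move=> kM; rewrite /labelled_sum big_distrr/=; apply: eq_big => [g|g].
  apply/andP/labellingsP => [[/labellingsP[H1 H2 H3] /forall_inP H]|[H1 H2 H3]].
    by split => // c cD; rewrite ltn_neqAle eq_sym H// H1.
  split; last by apply/forall_inP => c /H1; case: ltngtP.
  by apply/labellingsP; split => // c /H1/ltnW.
move=> /andP[/labellingsP[H1 H2 H3] /forall_inP H].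
rewrite label_weightS//; congr (w _ _ _ * _)%R.
  by rewrite big_pred0// => c; apply/negbTE/negP => /andP[/H/negbTE ->].
rewrite /total_size; apply: eq_bigl => c; case: (boolP (c \in D)) => //= cD.
by rewrite ltn_neqAle eq_sym H// H1.
Qed.

(** Resetting the label of [c] from [k.+1] to 0 is a bijection onto the labellings of [D :\ c] by
    labels above [k.+1]: by injectivity no other block has the label [k.+1]. *)
Lemma labelled_sum_used k D c : k < M -> c \in D ->
  (\sum_(g | labellings k D g && (g c == k.+1 :> nat)) label_weight k D g =
   w k (s c) (total_size D - s c)%N * labelled_sum k.+1 (D :\ c))%R.
Proof.
move=> kM cD; have kM1 : k.+1 < M.+1 by [].
pose x := Ordinal kM1.
have ordx (y : 'I_M.+1) : y = k.+1 :> nat -> y = x by move=> E; apply: val_inj.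
have inD c' : c' \in D -> c' != c -> c' \in D :\ c by rewrite !inE => -> ->.
rewrite (reindex_onto (fun g => relabel g c x) (fun g => relabel g c ord0)) /=.
  rewrite /labelled_sum big_distrr/=; apply: eq_big => [g|g].
    apply/andP/labellingsP => [[/andP[/labellingsP[H1 H2 H3] _] /eqP gE]|].
      have gc : g c = ord0 by rewrite -gE ffunE eqxx.
      split.
      - move=> c'; rewrite !inE => /andP[c'c c'D].
        have := H1 c' c'D; rewrite ffunE (negbTE c'c) => kg.
        rewrite ltn_neqAle kg andbT; apply/negP => /eqP kE.
        have := H3 c' c c'D cD; rewrite !ffunE eqxx (negbTE c'c).
        by move=> /(_ (ordx _ (esym kE)))/eqP; rewrite (negbTE c'c).
      - move=> c'; have [->//|c'c] := eqVneq c' c.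
        by rewrite !inE c'c/= => /H2; rewrite ffunE (negbTE c'c).
      - move=> c1 c2; rewrite !inE => /andP[n1 d1] /andP[n2 d2] gE12.
        by apply: H3 => //; rewrite !ffunE (negbTE n1) (negbTE n2).
    move=> [H1 H2 H3]; have gc : g c = ord0 by rewrite H2// !inE eqxx.
    split; last first.
      by apply/eqP/ffunP => c'; rewrite !ffunE; case: eqVneq => // ->.
    apply/andP; split; last by rewrite ffunE eqxx.
    apply/labellingsP; split.
    - move=> c' c'D; rewrite ffunE; case: eqVneq => // c'c.
      exact/ltnW/H1/inD.
    - move=> c' c'D; rewrite ffunE; case: eqVneq => [E|c'c].
        by rewrite E cD in c'D.
      by rewrite H2// !inE (negbTE c'D) andbF.
    - move=> c1 c2 d1 d2; rewrite !ffunE.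
      case: eqVneq => [->|n1]; case: eqVneq => [->//|n2].
      + by move=> E; have := H1 _ (inD _ d2 n2); rewrite -E /= ltnn.
      + by move=> E; have := H1 _ (inD _ d1 n1); rewrite E /= ltnn.
      + by apply: H3; exact: inD.
  move=> /andP[/andP[/labellingsP[H1 H2 H3] _] /eqP gE].
  rewrite label_weightS//; congr (w _ _ _ * _)%R.
  - rewrite (big_pred1 c)// => c'; rewrite ffunE; case: (eqVneq c' c) => [->|c'c].
      by rewrite cD /= !eqxx.
    rewrite /= (negbTE c'c); apply/negbTE/negP => /andP[c'D /eqP kE].
    have := H3 c' c c'D cD; rewrite !ffunE eqxx (negbTE c'c).
    by move=> /(_ (ordx _ kE))/eqP; rewrite (negbTE c'c).
  - rewrite /total_size [in RHS](bigD1 c)//= addKn; apply: eq_bigl => c'.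
    case: (boolP (c' \in D)) => //= c'D.
    rewrite ffunE; case: (eqVneq c' c) => [_|c'c]; first by rewrite ltnn.
    have := H1 c' c'D; rewrite ffunE (negbTE c'c) => kg.
    rewrite ltn_neqAle kg andbT; apply/negP => /eqP kE.
    have := H3 c' c c'D cD; rewrite !ffunE eqxx (negbTE c'c).
    by move=> /(_ (ordx _ (esym kE)))/eqP; rewrite (negbTE c'c).
  - rewrite /label_weight; apply: eq_big_nat => j /andP[kj jM].
    congr (w _ _ _); apply: eq_bigl => c'; rewrite !inE ffunE.
      case: (eqVneq c' c) => //= _; rewrite eqSS.
      by rewrite (ltn_eqF kj) andbF.
    case: (eqVneq c' c) => //= _; rewrite ltnS.
    by rewrite ltnNge (ltnW kj) andbF.
move=> g /andP[_ /eqP gc]; apply/ffunP => c'; rewrite !ffunE.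
by case: eqVneq => // ->; exact: val_inj.
Qed.

Lemma labelled_sum_rec k D : k < M ->
  (labelled_sum k D = w k 0 (total_size D) * labelled_sum k.+1 D +
   \sum_(c in D) w k (s c) (total_size D - s c)%N * labelled_sum k.+1 (D :\ c))%R.
Proof.
move=> kM; rewrite -labelled_sum_unused//.
under [X in (_ + X)%R]eq_bigr => c cD do rewrite -labelled_sum_used//.
rewrite (exchange_big_dep (labellings k D))/=; last by move=> c g _ /andP[].
rewrite {1}/labelled_sum.
rewrite (bigID (fun g => [forall c in D, g c != k.+1 :> nat]))/=; congr (_ + _)%R.
(* After the exchange of sums, a labelling that avoids [k.+1] contributes nothing on the right, and
   any other is counted once, since only one block can carry that label. *)
rewrite [RHS](bigID (fun g => [forall c in D, g c != k.+1 :> nat]))/=.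
rewrite [X in (_ = X + _)%R]big1 ?add0r.
  apply: eq_bigr => g /andP[Lg]; rewrite negb_forall_in => /exists_inP[c cD].
  rewrite negbK => gc; have /labellingsP[_ _ H3] := Lg.
  rewrite (big_pred1 c)// => c'; rewrite Lg/=.
  apply/andP/eqP => [[c'D /eqP gc']|->//].
  by apply: H3 => //; apply: val_inj; rewrite /= gc' (eqP gc).
move=> g /andP[_ /forall_inP H]; rewrite big_pred0// => c.
by apply/negbTE/negP => /andP[cD /andP[_]]; rewrite (negbTE (H c cD)).
Qed.

End labelled_sums.

(** * The limiting partition probabilities *)

Section eppf.
Context {R : realType} {I : finType}.
Variables (s : I -> nat) (d : R).
Hypothesis d01 : 0 < d < 1.
Implicit Types (D : {set I}) (alpha : R) (m n k : nat).

Let d0 : 0 < d. Proof. by case/andP: d01. Qed.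
Let d1 : 0 < 1 - d. Proof. by case/andP: d01; rewrite subr_gt0. Qed.

(** Starting here and in [shifted_factorial] at index 1 is the cancellation of the common factor
    [alpha]. Both products are then positive for all [alpha > - d], and [alpha = 0] is no special
    case. *)
Definition stick_product alpha k := \prod_(1 <= i < k) (alpha + i%:R * d).

Definition shifted_factorial alpha n := \prod_(1 <= i < n) (alpha + i%:R).

Definition block_product D := \prod_(c in D) rising_factorial (1 - d) (s c - 1).

(** This is the exchangeable partition probability function of the two-parameter Pitman-Yor
    family. *)
Definition eppf alpha D :=
  stick_product alpha #|D| / shifted_factorial alpha (total_size s D) *
  block_product D.

(** The moment of [v^m (1 - v)^k] for [v] of law Beta with parameters [1 - d] and [alpha + d]. *)
Definition stick_moment alpha m k :=
  rising_factorial (1 - d) m * rising_factorial (alpha + d) k /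
  rising_factorial (alpha + 1) (m + k).

Lemma stick_product_gt0 alpha k : - d < alpha -> 0 < stick_product alpha k.
Proof.
move=> ad; rewrite /stick_product big_seq_cond; apply: prodr_gt0 => i.
rewrite andbT mem_index_iota => /andP[i1 _].
have : d <= i%:R * d by rewrite ler_peMl ?ler1n// ltW.
lra.
Qed.

Lemma shifted_factorial_gt0 alpha n : - d < alpha -> 0 < shifted_factorial alpha n.
Proof.
move=> ad; rewrite /shifted_factorial big_seq_cond; apply: prodr_gt0 => i.
rewrite andbT mem_index_iota => /andP[i1 _].
have : 1 <= i%:R :> R by rewrite ler1n.
have := d1; lra.
Qed.

Lemma block_product_gt0 D : 0 < block_product D.
Proof. by apply: prodr_gt0 => c _; exact: rising_factorial_gt0. Qed.

Lemma eppf_gt0 alpha D : - d < alpha -> 0 < eppf alpha D.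
Proof.
move=> ad; rewrite mulr_gt0 ?block_product_gt0// divr_gt0//.
  exact: stick_product_gt0.
exact: shifted_factorial_gt0.
Qed.

Lemma stick_productS alpha k : (0 < k)%N ->
  stick_product alpha k.+1 = stick_product alpha k * (alpha + k%:R * d).
Proof. by move=> k0; rewrite /stick_product big_nat_recr. Qed.

Lemma stick_product_shift alpha k : (0 < k)%N ->
  stick_product alpha k.+1 = (alpha + d) * stick_product (alpha + d) k.
Proof.
move=> k0; rewrite /stick_product big_ltn// mul1r; congr (_ * _).
rewrite big_add1/=; apply: eq_big_nat => i _; rewrite -natr1; ring.
Qed.

Lemma rising_factorial_shift x n : (0 < n)%N ->
  rising_factorial x n = x * shifted_factorial x n.
Proof.
case: n => // n _; rewrite /rising_factorial -(big_mkord xpredT (fun j => x + j%:R)).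
by rewrite big_ltn// addr0.
Qed.

Lemma rising_factorial_succ alpha n : (0 < n)%N ->
  rising_factorial (alpha + 1) n = shifted_factorial alpha n * (alpha + n%:R).
Proof.
case: n => // n _; rewrite /shifted_factorial -big_nat_recr//=.
rewrite /rising_factorial -(big_mkord xpredT (fun j => alpha + 1 + j%:R)).
by rewrite [RHS]big_add1; apply: eq_big_nat => i _; rewrite -natr1; ring.
Qed.

Hypothesis s0 : forall c, (0 < s c)%N.

Lemma total_size_ge D : (#|D| <= total_size s D)%N.
Proof. by rewrite -sum1_card; apply: leq_sum. Qed.

Lemma total_sizeD1 D c : c \in D -> total_size s D = (s c + total_size s (D :\ c))%N.
Proof. by move=> cD; rewrite /total_size (big_setD1 c). Qed.

Lemma eppf_set0 alpha : eppf alpha finset.set0 = 1.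
Proof.
rewrite /eppf /total_size /block_product cards0 !big_set0.
by rewrite /stick_product /shifted_factorial !big_geq// divr1 mulr1.
Qed.

Lemma stick_moment00 alpha : stick_moment alpha 0 0 = 1.
Proof. by rewrite /stick_moment /rising_factorial !big_ord0 divr1 mulr1. Qed.

(** The last factor is the probability of opening a new block in the two-parameter Chinese
    restaurant process. In [eppf_used] it is the probability of joining the block [c]. *)
Lemma eppf_unused alpha D : - d < alpha -> D != finset.set0 ->
  stick_moment alpha 0 (total_size s D) * eppf (alpha + d) D =
  eppf alpha D * ((alpha + #|D|%:R * d) / (alpha + (total_size s D)%:R)).
Proof.
move=> ad D0.
have K0 : (0 < #|D|)%N by rewrite card_gt0.
have N0 : (0 < total_size s D)%N by rewrite (leq_trans K0)// total_size_ge.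
have ad' : - d < alpha + d by have := d0; lra.
(* One product of [#|D|] factors is written in two ways, with its last or its first factor split
   off. *)
have := stick_product_shift alpha K0; rewrite stick_productS// => E.
have B0 := shifted_factorial_gt0 (total_size s D) ad'.
have A0 := shifted_factorial_gt0 (total_size s D) ad.
have aN : 0 < alpha + (total_size s D)%:R.
  have : 1 <= (total_size s D)%:R :> R by rewrite ler1n.
  have := d1; lra.
rewrite /stick_moment /eppf add0n (rising_factorial_shift (alpha + d))//.
rewrite rising_factorial_succ//.
rewrite [rising_factorial _ 0]big_ord0.
transitivity ((alpha + d) * stick_product (alpha + d) #|D| /
    (shifted_factorial alpha (total_size s D) *
     (alpha + (total_size s D)%:R)) * block_product D).
  by field; rewrite !gt_eqF.
by rewrite -E; field; rewrite !gt_eqF.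
Qed.

Lemma eppf_used alpha D c : - d < alpha -> c \in D ->
  stick_moment alpha (s c) (total_size s D - s c) * eppf (alpha + d) (D :\ c) =
  eppf alpha D * (((s c)%:R - d) / (alpha + (total_size s D)%:R)).
Proof.
move=> ad cD.
have ND := total_sizeD1 cD; have KD : #|D| = #|D :\ c|.+1 by rewrite (cardsD1 c) cD.
have K0 : (0 < #|D|)%N by rewrite KD.
have N0 : (0 < total_size s D)%N by rewrite (leq_trans K0)// total_size_ge.
have ad' : - d < alpha + d by have := d0; lra.
have A0 := shifted_factorial_gt0 (total_size s D) ad.
have aN : 0 < alpha + (total_size s D)%:R.
  have : 1 <= (total_size s D)%:R :> R by rewrite ler1n.
  have := d1; lra.
have bE : block_product D = rising_factorial (1 - d) (s c - 1) * block_product (D :\ c).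
  by rewrite /block_product (big_setD1 c).
have rE : rising_factorial (1 - d) (s c) =
    rising_factorial (1 - d) (s c - 1) * ((s c)%:R - d).
  rewrite -{1}(subnK (s0 c)) addn1 rising_factorialS natrB//; congr (_ * _); ring.
suff E : rising_factorial (alpha + d) (total_size s (D :\ c)) *
    eppf (alpha + d) (D :\ c) = stick_product alpha #|D| * block_product (D :\ c).
  rewrite /stick_moment subnKC; last by rewrite ND leq_addr.
  rewrite {1}ND addKn rising_factorial_succ// rE.
  rewrite -mulrA [_^-1 * eppf _ _]mulrC mulrA -[X in X / _]mulrA E /eppf bE.
  by field; rewrite !gt_eqF.
(* If [c] is the only block, [rising_factorial_shift] does not apply, and all the products are
   empty. *)
have [D0|D0] := eqVneq (D :\ c) finset.set0.
  rewrite KD /eppf /total_size /block_product D0 cards0 !big_set0.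
  rewrite /stick_product /shifted_factorial /rising_factorial.
  by rewrite !big_geq// big_ord0 divr1 !mulr1.
have K1 : (0 < #|D :\ c|)%N by rewrite card_gt0.
have N1 : (0 < total_size s (D :\ c))%N by rewrite (leq_trans K1)// total_size_ge.
rewrite rising_factorial_shift// KD stick_product_shift// /eppf.
by field; rewrite gt_eqF// shifted_factorial_gt0.
Qed.

Lemma eppf_rec alpha D : - d < alpha ->
  eppf alpha D = stick_moment alpha 0 (total_size s D) * eppf (alpha + d) D +
    \sum_(c in D) stick_moment alpha (s c) (total_size s D - s c) *
                  eppf (alpha + d) (D :\ c).
Proof.
(* The empty collection is treated apart, since the denominator [alpha + N] could vanish there. *)
move=> ad; have [->|D0] := eqVneq D finset.set0.
  by rewrite big_set0 addr0 !eppf_set0 /total_size big_set0 stick_moment00 mulr1.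
have K0 : (0 < #|D|)%N by rewrite card_gt0.
have N0 : (0 < total_size s D)%N by rewrite (leq_trans K0)// total_size_ge.
have aN : 0 < alpha + (total_size s D)%:R.
  have : 1 <= (total_size s D)%:R :> R by rewrite ler1n.
  have := d1; lra.
rewrite eppf_unused//; under eq_bigr => c cD do rewrite eppf_used//.
rewrite -mulr_sumr -mulrDr -mulr_suml sumrB sumr_const.
rewrite -natr_sum -/(total_size s D) -[d *+ _]mulr_natl -mulrDl.
have -> : alpha + #|D|%:R * d + ((total_size s D)%:R - #|D|%:R * d) =
  alpha + (total_size s D)%:R by ring.
by rewrite divff ?mulr1// gt_eqF.
Qed.

End eppf.

(** * Truncation error *)

Section truncation.
Context {R : realType} {I : finType}.
Variables (s : I -> nat) (alpha d : R).
Hypothesis d01 : 0 < d < 1.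
Hypothesis ad : - d < alpha.
Hypothesis s0 : forall c, (0 < s c)%N.

Let d0 : 0 < d. Proof. by case/andP: d01. Qed.
Let d1 : 0 < 1 - d. Proof. by case/andP: d01; rewrite subr_gt0. Qed.

(** The index [j] counts from 0 and belongs to [v_(j+1)], whose second parameter is
    [alpha + j d + d]. *)
Definition stick_weight (j a b : nat) : R := stick_moment d (alpha + j%:R * d) a b.

(** It uses a bound [n] on the total size, so that one factor serves all the collections met in the
    recursion. *)
Definition escape_factor (n j : nat) : R := 1 - (1 - d) / (alpha + j%:R * d + n%:R).

Let adj j : - d < alpha + j%:R * d.
Proof. by rewrite ltr_wpDr// mulr_ge0// ltW. Qed.

Let y0 n j : (0 < n)%N -> 1 - d < alpha + j%:R * d + n%:R.
Proof. by move=> n0; have := adj j; have : 1 <= n%:R :> R by [rewrite ler1n]; lra. Qed.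

Lemma escape_factor_ge0 n j : (0 < n)%N -> 0 <= escape_factor n j.
Proof.
move=> n0; have y := y0 j n0.
by rewrite subr_ge0 ler_pdivrMr ?mul1r ?(lt_trans d1 y)// ltW.
Qed.

Lemma stick_weight_ge0 j a b : 0 <= stick_weight j a b.
Proof.
have := adj j; move=> aj.
rewrite /stick_weight /stick_moment divr_ge0// ?mulr_ge0// ltW//.
- exact: rising_factorial_gt0.
- by apply: rising_factorial_gt0; lra.
- by apply: rising_factorial_gt0; have := d1; lra.
Qed.

(* Writing the error as [eppf * r], the ratio [r] at level [k] is a convex
   combination of ratios at level [k.+1]: [r D] with weight
   [(alpha + k d + #|D| d) / (alpha + k d + N)] and [r (D :\ c)] with weight
   [(s c - d) / (alpha + k d + N)], where [N = total_size s D]. *)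
Lemma labelled_sum_error n M k (D : {set I}) : (0 < n)%N -> (k <= M)%N ->
  (total_size s D <= n)%N ->
  0 <= eppf s d (alpha + k%:R * d) D - labelled_sum s stick_weight M k D <=
  eppf s d (alpha + k%:R * d) D * #|D|%:R * \prod_(k <= j < M) escape_factor n j.
Proof.
move=> n0 kM; move: {2}(M - k)%N (erefl (M - k)%N) => i.
elim: i k kM D => [|i IH] k kM D Mk Dn.
  have {Mk kM} -> : k = M by apply/eqP; rewrite eqn_leq kM -subn_eq0 Mk.
  (* With no label left, the error is 0 for the empty collection and the whole [eppf] otherwise,
     where the factor [#|D|] is at least 1. *)
  rewrite labelled_sum_last big_geq// mulr1; have [->|D0] := eqVneq D finset.set0.
    by rewrite cards0 mulr0 eppf_set0 subrr lexx.
  have e0 := ltW (eppf_gt0 s d01 D (adj M)).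
  by rewrite subr0 e0 ler_peMr// ler1n card_gt0.
have kM' : (k < M)%N by rewrite -subn_gt0 Mk.
have Mk1 : (M - k.+1)%N = i by rewrite subnS Mk.
have [->|D0] := eqVneq D finset.set0.
  have ts0 : total_size s finset.set0 = 0%N by rewrite /total_size big_set0.
  have := IH k.+1 kM' finset.set0 Mk1; rewrite ts0 => /(_ isT).
  rewrite !eppf_set0 cards0 !mulr0 !mul0r (labelled_sum_rec _ _ _ kM') big_set0.
  by rewrite ts0 /stick_weight stick_moment00 mul1r addr0.
rewrite (big_ltn kM') labelled_sum_rec//.
set rho := \prod_(k.+1 <= j < M) _.
have rho0 : 0 <= rho by apply: prodr_ge0 => j _; exact: escape_factor_ge0.
have aS : alpha + k.+1%:R * d = alpha + k%:R * d + d by rewrite -natr1; ring.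
have IHD := IH k.+1 kM' D Mk1 Dn; rewrite aS in IHD.
have IHc c : c \in D -> 0 <= eppf s d (alpha + k%:R * d + d) (D :\ c)
    - labelled_sum s stick_weight M k.+1 (D :\ c) <=
    eppf s d (alpha + k%:R * d + d) (D :\ c) * #|D :\ c|%:R * rho.
  move=> cD; rewrite -aS; apply: IH => //.
  by apply: leq_trans Dn; rewrite (total_sizeD1 s cD) leq_addl.
have K0 : (0 < #|D|)%N by rewrite card_gt0.
have KN : (#|D| <= total_size s D)%N by exact: total_size_ge.
have Kc c : c \in D -> #|D :\ c|%:R = #|D|%:R - 1 :> R.
  by move=> cD; rewrite (cardsD1 c D) cD natrD addrC addKr.
rewrite (eppf_rec d01 s0 D (adj k)).
rewrite opprD addrACA -mulrBr -sumrB.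
under [X in _ + X]eq_bigr do rewrite -mulrBr.
apply/andP; split.
  rewrite addr_ge0//.
    by rewrite mulr_ge0 ?stick_weight_ge0//; case/andP: IHD.
  apply: sumr_ge0 => c cD; rewrite mulr_ge0 ?stick_weight_ge0//.
  by case/andP: (IHc c cD).
(* The induction hypothesis bounds each ratio by a number of blocks times [rho]. This number drops
   to [#|D| - 1] when a block is removed, which is the source of the contraction. *)
apply: (@le_trans _ _ (
  stick_moment d (alpha + k%:R * d) 0 (total_size s D) *
    eppf s d (alpha + k%:R * d + d) D * (#|D|%:R * rho) +
  \sum_(c in D) stick_moment d (alpha + k%:R * d) (s c) (total_size s D - s c) *
    eppf s d (alpha + k%:R * d + d) (D :\ c) * ((#|D|%:R - 1) * rho))).
  apply: lerD.
    rewrite -mulrA ler_wpM2l ?stick_weight_ge0// mulrA.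
    by case/andP: IHD.
  apply: ler_sum => c cD; rewrite -mulrA ler_wpM2l ?stick_weight_ge0//.
  by rewrite mulrA -(Kc c cD); case/andP: (IHc c cD).
rewrite -(eppf_rec d01 s0 D (adj k)) (eppf_unused d01 s0 (adj k) D0).
under eq_bigr => c cD do rewrite (eppf_used d01 s0 (adj k) cD).
rewrite -!mulr_suml -mulr_sumr -mulr_suml sumrB sumr_const.
rewrite -natr_sum -/(total_size s D) -[d *+ _]mulr_natl.
set p := eppf _ _ _ _; set K := #|D|%:R; set N := (total_size s D)%:R.
rewrite /escape_factor.
have A0 : 0 < alpha + k%:R * d + N.
  exact: lt_trans d1 (y0 k (leq_trans K0 KN)).
have B0 : 0 < alpha + k%:R * d + n%:R by exact: lt_trans d1 (y0 k n0).
(* The left of the target equals [p * rho * (K - (N - K d) / (alpha + k d + N))]. The drop is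
   bounded below using [K <= N <= n]. *)
have h : K * (1 - d) / (alpha + k%:R * d + n%:R) <=
    (N - K * d) / (alpha + k%:R * d + N).
  apply: ler_pM.
  - by rewrite mulr_ge0// ltW.
  - by rewrite invr_ge0 ltW.
  - by rewrite mulrBr mulr1 lerD2r ler_nat.
  - by rewrite lef_pV2 ?posrE// lerD2l ler_nat.
rewrite -subr_ge0.
have p0 : 0 <= p by rewrite ltW// eppf_gt0.
rewrite [leRHS](_ : _ = p * rho * ((N - K * d) / (alpha + k%:R * d + N) -
    K * (1 - d) / (alpha + k%:R * d + n%:R))).
  by rewrite mulr_ge0 ?subr_ge0// mulr_ge0.
by field; rewrite !gt_eqF.
Qed.

Lemma bernoulli_ineq (x : R) m : 0 <= x -> 1 + m%:R * x <= (1 + x) ^+ m.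
Proof.
move=> x0; elim: m => [|m IH]; first by rewrite mul0r addr0 expr0.
rewrite exprS -natr1; apply: (@le_trans _ _ ((1 + x) * (1 + m%:R * x))).
  have : 0 <= m%:R * x * x by rewrite !mulr_ge0.
  lra.
by rewrite ler_wpM2l// addr_ge0.
Qed.

(* For [m (1 - d) >= d], Bernoulli's inequality bounds the [m]-th power of the
   [j]-th factor by [y j / y j.+1] with [y j = alpha + j d + n]. *)
Lemma escape_prob_cvg0 n : (0 < n)%N ->
  (fun M => \prod_(0 <= j < M) escape_factor n j) @ \oo --> (0 : R).
Proof.
move=> n0.
pose y j : R := alpha + j%:R * d + n%:R.
have yp j : 0 < y j by exact: lt_trans d1 (y0 j n0).
have [m dm] : exists m : nat, d <= m.+1%:R * (1 - d).
  exists (Num.truncn (d / (1 - d))).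
  by rewrite -ler_pdivrMr// ltW// truncnS_gt.
have step j : escape_factor n j ^+ m.+1 <= y j / y j.+1.
  have x0 : 0 <= (1 - d) / y j by rewrite divr_ge0// ltW.
  have b := bernoulli_ineq m.+1 x0.
  have yS : y j.+1 = y j + d by rewrite /y -natr1; ring.
  have h : y j.+1 / y j <= (1 + (1 - d) / y j) ^+ m.+1.
    apply: le_trans b; rewrite yS mulrDl divff ?gt_eqF// lerD2l mulrA.
    by rewrite ler_pM2r ?invr_gt0.
  have y1 : 0 < y j.+1 / y j by rewrite divr_gt0.
  rewrite -[leRHS]invf_div -[leRHS]mul1r ler_pdivlMr//.
  apply: le_trans (ler_wpM2l _ h) _; first exact/exprn_ge0/escape_factor_ge0.
  (* With [x = (1 - d) / y j], the base is [(1 - x) (1 + x)], at most 1. *)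
  rewrite -exprMn exprn_ile1//.
    by rewrite mulr_ge0 ?escape_factor_ge0// addr_ge0.
  rewrite /escape_factor -/(y j); move: ((1 - d) / y j) x0 => x x0.
  by rewrite mulrDr mulr1 mulrBl mul1r addrA subrK gerBl mulr_ge0.
(* The quotients telescope, and [y M] grows linearly in [M]. *)
have bound M : (\prod_(0 <= j < M) escape_factor n j) ^+ m.+1 <= y 0 / y M.
  elim: M => [|M IH].
    by rewrite big_geq// expr1n divff// gt_eqF.
  rewrite big_nat_recr//= exprMn.
  apply: (@le_trans _ _ (y 0 / y M * (y M / y M.+1))).
    by rewrite ler_pM// exprn_ge0// ?prodr_ge0 // => *; exact: escape_factor_ge0.
  by rewrite mulrA divfK// gt_eqF.
apply/cvgr0Pnorm_lt => e e0.
have ee0 : 0 < e ^+ m.+1 by rewrite exprn_gt0.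
near=> M.
have r0 : 0 <= \prod_(0 <= j < M) escape_factor n j.
  by apply: prodr_ge0 => j _; exact: escape_factor_ge0.
rewrite ger0_norm// -(@ltr_pXn2r _ m.+1) ?nnegrE ?(ltW e0)//.
apply: le_lt_trans (bound M) _.
rewrite ltr_pdivrMr// mulrC -ltr_pdivrMr//.
have yM : y 0 / e ^+ m.+1 / d < M%:R by near: M; exact: nbhs_infty_gtr.
rewrite ltr_pdivrMr// in yM. apply: (lt_le_trans yM).
have := ltW (yp 0); rewrite /y mul0r addr0 => an.
by rewrite addrAC lerDr.
Unshelve. all: by end_near. Qed.

Lemma labelled_sum_cvg (D : {set I}) :
  (fun M => labelled_sum s stick_weight M 0 D) @ \oo --> eppf s d alpha D.
Proof.
(* The successor keeps the bound positive even for the empty collection. *)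
pose n := (total_size s D).+1.
have E M : 0 <= eppf s d alpha D - labelled_sum s stick_weight M 0 D <=
  eppf s d alpha D * #|D|%:R * \prod_(0 <= j < M) escape_factor n j.
  by have := @labelled_sum_error n M 0 D (ltn0Sn _) (leq0n _) (leqnSn _);
     rewrite mul0r addr0.
have c0 : (fun M => eppf s d alpha D * #|D|%:R *
    \prod_(0 <= j < M) escape_factor n j) @ \oo --> (0 : R).
  rewrite -(mulr0 (eppf s d alpha D * #|D|%:R)); apply: cvgMr => //.
  exact: escape_prob_cvg0.
have : (fun M => eppf s d alpha D - labelled_sum s stick_weight M 0 D) @ \oo --> (0 : R).
  by apply: (squeeze_cvgr _ (cvg_cst 0) c0); exact: nearW.
move=> /(cvgB (cvg_cst (eppf s d alpha D))); rewrite subr0.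
by apply: cvg_trans; apply: near_eq_cvg; apply: nearW => M /=; rewrite subKr.
Qed.

End truncation.

(** * Labels and partitions *)

Section set_partitions.
Context {n : nat}.
Implicit Types (C : {set {set 'I_n}}) (z : 'I_n -> nat).

Lemma induced_partitionP C z : finset.partition C [set: 'I_n]%SET -> reflect
  (forall i i', (z i == z i') = (finset.pblock C i == finset.pblock C i'))
  (induced_partition z == C).
Proof.
move=> pC; have [/eqP cC tC _] := and3P pC.
have mC i : i \in finset.cover C by rewrite cC inE.
apply: (iffP eqP) => [<- i i'|H].
  have /and3P[/eqP cz tz _] := preim_partitionP z [set: 'I_n]%SET.
  rewrite eq_pblock ?cz ?inE// pblock_equivalence_partition ?inE//.
  by split=> // /eqP ->.
rewrite -[RHS](preim_partition_pblock pC) /induced_partition.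
apply: eq_in_imset => i _; apply/setP => i'; rewrite !inE H.
by [].
Qed.

Lemma prod_blocks (R : comPzRingType) C (F : {set 'I_n} -> R) :
  finset.partition C [set: 'I_n]%SET ->
  \prod_i F (finset.pblock C i) = \prod_(c in C) F c ^+ #|c|.
Proof.
move=> pC; have [/eqP cC tC _] := and3P pC.
transitivity (\prod_(i in [set: 'I_n]%SET) F (finset.pblock C i)).
  by apply: eq_bigl => i; rewrite inE.
rewrite -cC finset.big_trivIset//=; apply: eq_bigr => c cinC.
rewrite -prodr_const; apply: eq_bigr => i ic.
by rewrite (def_pblock tC cinC ic).
Qed.

End set_partitions.

(** The product is regrouped by sticks instead of blocks: a block [c] contributes [x] at its own
    label and [y] at every smaller one. Labels start at 1 and [j] at 0, hence the predecessors in
    the proof. *)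
Lemma stick_product_labels (R : comPzRingType) (I : finType) (s : I -> nat) M
    (x y : nat -> R) (D : {set I}) (g : {ffun I -> 'I_M.+1}) :
  labellings 0 D g ->
  \prod_(c in D) (x (g c) * \prod_(1 <= i < g c) y i) ^+ s c =
  \prod_(0 <= j < M) (x j.+1 ^+ (\sum_(c in D | g c == j.+1 :> nat) s c)%N *
                      y j.+1 ^+ (\sum_(c in D | (j.+1 < g c)%N) s c)%N).
Proof.
move=> /labellingsP[gD _ _].
under [RHS]eq_bigr do rewrite !expr_sum !big_mkcondr/= -big_split/=.
rewrite exchange_big/=; apply: eq_bigr => c cD.
have g0 := gD c cD; have gM : (g c <= M)%N by rewrite -ltnS ltn_ord.
have gP : ((g c).-1 < M)%N by rewrite prednK.
rewrite big_split/= -!big_mkcond/= exprMn -prodrXl; congr (_ * _).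
  transitivity (\prod_(0 <= j < M | j == (g c).-1) x j.+1 ^+ s c).
    rewrite big_mkord (big_pred1 (Ordinal gP))//=.
    by rewrite prednK.
  by apply: eq_bigl => j; rewrite -(eqn_add2r 1) !addn1 prednK// eq_sym.
rewrite big_add1 [RHS](big_cat_nat _ (n := (g c).-1))//=; last exact: ltnW.
rewrite [X in _ = _ * X]big_nat_cond [X in _ = _ * X]big_pred0 ?mulr1; last first.
  move=> j; apply/negbTE/negP => /andP[/andP[gj _]].
  by rewrite -ltn_predRL ltnNge gj.
rewrite [RHS]big_nat_cond [LHS]big_nat_cond; apply: eq_bigl => j.
by case: (ltnP j (g c).-1) => //= jg; rewrite -ltn_predRL jg.
Qed.

(** * Mixed moments of the sticks and the joint law of the labels *)

Section stick_breaking_labels.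
Context {R : realType} {disp : measure_display} {T : measurableType disp}.
Variables (P : probability T R) (d alpha : R).
Variable v : nat -> {RV P >-> R}.
Hypothesis d01 : 0 < d < 1.
Hypothesis ad : - d < alpha.
Hypothesis indv : mutually_independent [set i | (1 <= i)%N] v.
Hypothesis lawv : forall i, (1 <= i)%N -> forall A : set R, measurable A ->
  distribution P (v i) A = beta_law (1 - d) (alpha + i%:R * d) A.

Lemma expectation_stick_monomial (M : nat) (a b : nat -> nat) :
  (\int[P]_w (\prod_(0 <= j < M)
     (v j.+1 w ^+ a j * (1 - v j.+1 w) ^+ b j))%:E)%E =
  (\prod_(0 <= j < M) stick_weight alpha d j (a j) (b j))%:E.
Proof.
have [d0 d1] := andP d01.
have vE i : (1 <= i)%N ->
    (\int[P]_w (unit_monomial (a i.-1) (b i.-1) (v i w))%:E)%E =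
    (stick_weight alpha d i.-1 (a i.-1) (b i.-1))%:E.
  move=> i1; have ai : 0 < alpha + i%:R * d.
    have : d <= i%:R * d by rewrite ler_peMl ?ler1n// ltW.
    have := ad; lra.
  rewrite (expectation_unit_monomial (lawv i1)) ?subr_gt0//.
  have iE : i%:R = i.-1%:R + 1 :> R by rewrite natr1 prednK.
  rewrite /stick_weight /stick_moment iE.
  by congr (_ * rising_factorial _ _ / rising_factorial _ _)%:E; ring.
pose f i w := \prod_(0 <= j < i) unit_monomial (a j) (b j) (v j.+1 w).
(* The sticks lie in the open unit interval only almost surely, so the monomials are first replaced
   by their truncations. *)
transitivity (\int[P]_w (f M w)%:E)%E.
  apply: ae_eq_integral => //.
  - apply/measurable_EFinP/measurable_prod => j _.
    apply: measurable_funM; apply: measurable_funX => //.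
    exact: measurable_funB.
  - apply/measurable_EFinP/measurable_prod => j _.
    exact: (measurableT_comp (measurable_unit_monomial _ _)).
  - have : \forall w \ae P, forall j, 0 < v j.+1 w < 1.
      apply: ae_foralln => j.
      exists (v j.+1 @^-1` (~` `]0, 1[%classic)); split.
      + rewrite -[X in measurable X]setTI; apply: measurable_funPT => //.
        exact: measurableC.
      + exact: beta_variable_unit (lawv (ltn0Sn j)).
      + by move=> w /= H; rewrite in_itv.
    apply: filterS => w vw _; congr EFin; rewrite /f.
    by apply: eq_bigr => j _; rewrite /unit_monomial vw.
pose J : {fset nat} := seq_fset tt (iota 1 M).
have JE (F : nat -> \bar R) :
    (\prod_(i <- J) F i)%E = (\prod_(0 <= j < M) F j.+1)%E.
  rewrite (perm_big (index_iota 1 M.+1)) ?big_add1//.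
  by rewrite /index_iota subn1 -[X in perm_eq _ X]undup_id ?iota_uniq// seq_fset_perm.
(* The law of [v 0] is unspecified; the constant 1 at index 0 has a finite expectation in any
   case. *)
pose g i := if (1 <= i)%N then unit_monomial (a i.-1) (b i.-1) else cst (1 : R).
have JD : [set` J] `<=` [set i | (1 <= i)%N].
  by move=> i /=; rewrite seq_fsetE mem_iota => /andP[].
have gE j w : g j.+1 (v j.+1 w) = unit_monomial (a j) (b j) (v j.+1 w) by [].
transitivity (\int[P]_w (\prod_(i <- J) g i (v i w))%:E)%E.
  by apply: eq_integral => w _; rewrite -[RHS]prodEFin JE prodEFin.
rewrite (ge0_expectation_prod indv JD).
- rewrite JE -prodEFin; apply: eq_bigr => j _.
  exact: (vE j.+1).
- by rewrite /g => -[|i] //=; exact: measurable_unit_monomial.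
- by rewrite /g => -[|i] y //=; exact: unit_monomial_ge0.
- rewrite /g => -[|i] /=; first by rewrite integral_cst// fin_numM// fin_num_measure.
  by rewrite (vE i.+1).
Qed.

(** By conditional independence the product of the [pi (h i)] is a version of the conditional
    probability of the joint event; it is integrated over the whole space. *)
Lemma prob_stick_labels n (z : 'I_n -> {RV P >-> nat})
    (pi := stick_breaking (fun i => v i : T -> R))
    (h : 'I_n -> nat) :
  cond_independent (sigma_seq pi) z ->
  (forall i j, (1 <= j)%N ->
     cond_prob P (sigma_seq pi) (z i @^-1` [set j]) (pi j)) ->
  (forall i, (1 <= h i)%N) ->
  P (\bigcap_i z i @^-1` [set h i]) = (\int[P]_w (\prod_i pi (h i) w)%:E)%E.
Proof.
move=> ci cp h1.
have [//|_ _ /(_ setT)] :=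
  ci (fun i => [set h i]) (fun i => pi (h i)) _ (fun i => cp i _ (h1 i)).
rewrite setTI => -> //.
by rewrite -(setD0 setT); apply: sigma_algebraCD; exact: sigma_algebra0.
Qed.

End stick_breaking_labels.

(** The size [#|c|.-1.+1] is [#|c|] on blocks and 1 on the empty set, because the recursion for
    [eppf] asks for positive sizes on the whole index type. *)
Lemma eppf_formula (R : realType) (n : nat) (d alpha : R) (C : {set {set 'I_n}}) :
  0 < d < 1 -> - d < alpha -> (1 <= n)%N ->
  finset.partition C [set: 'I_n]%SET ->
  eppf (fun c : {set 'I_n} => #|c|.-1.+1) d alpha C =
  (if alpha == 0
    then (\prod_(1 <= i < #|C|) (alpha + i%:R * d)) /
         (\prod_(1 <= i < n) (alpha + i%:R))
    else d ^+ #|C| / rising_factorial alpha n *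
         rising_factorial (alpha / d) #|C|) *
   \prod_(c in C) rising_factorial (1 - d) (#|c| - 1).
Proof.
move=> d01 ad n1 pC; have [/eqP cC tC C0] := and3P pC.
have sE c : c \in C -> #|c|.-1.+1 = #|c|.
  move=> cinC; rewrite prednK// card_gt0; apply/negP => /eqP c0.
  by rewrite -c0 cinC in C0.
have NE : total_size (fun c : {set 'I_n} => #|c|.-1.+1) C = n.
  rewrite /total_size; under eq_bigr => c cinC do rewrite sE//.
  by rewrite -(card_partition pC) cardsT card_ord.
have K0 : (0 < #|C|)%N.
  rewrite card_gt0; apply/negP => /eqP CE; move: n1; rewrite -NE CE.
  by rewrite /total_size big_set0.
rewrite /eppf NE; congr (_ * _); last first.
  by apply: eq_bigr => c cinC; rewrite subn1 /= subn1.
case: eqVneq => [->//|a0].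
have d0 : d != 0 by case/andP: d01 => /gt_eqF ->.
(* The factor [alpha] split off here cancels the first factor of [rising_factorial alpha n]. *)
have -> : rising_factorial (alpha / d) #|C| = alpha / d ^+ #|C| * stick_product d alpha #|C|.
  case: #|C| K0 => // K _; rewrite rising_factorial_shift// /shifted_factorial.
  have E : \prod_(1 <= i < K.+1) (alpha / d + i%:R) =
      stick_product d alpha K.+1 / d ^+ K.
    rewrite /stick_product !big_add1/= -[K in d ^+ K]subn0.
    rewrite -prodr_const_nat -prodf_div; apply: eq_bigr => i _.
    by rewrite mulrDl mulfK.
  rewrite E exprS; move: (stick_product _ _ _) => S.
  by rewrite invfM; field; rewrite d0 expf_neq0.
rewrite rising_factorial_shift//.
have := shifted_factorial_gt0 d01 n ad => /gt_eqF/negbT B0.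
have dK : d ^+ #|C| != 0 by rewrite expf_neq0.
move: (stick_product _ _ _) (shifted_factorial _ _) (d ^+ _) B0 dK => S B x B0 x0.
by field; rewrite a0 B0 x0.
Qed.

(** * The law of the induced partition *)

Theorem theorem2p1 (R : realType) (disp : measure_display)
    (T : measurableType disp) (P : probability T R)
    (d alpha : R) (n : nat)
    (v : nat -> {RV P >-> R}) (z : 'I_n -> {RV P >-> nat})
    (pi := stick_breaking (fun i => v i : T -> R)) :
  0 < d < 1 -> - d < alpha -> (1 <= n)%N ->
  mutually_independent [set i | (1 <= i)%N] v ->
  (forall i, (1 <= i)%N -> forall A : set R, measurable A ->
     distribution P (v i) A = beta_law (1 - d) (alpha + i%:R * d) A) ->
  (forall i w, (1 <= z i w)%N) ->
  cond_independent (sigma_seq pi) z ->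
  (forall i j, (1 <= j)%N ->
     cond_prob P (sigma_seq pi) (z i @^-1` [set j]) (pi j)) ->
  forall C : {set {set 'I_n}}, finset.partition C [set: 'I_n]%SET ->
  P [set w | induced_partition (fun i => z i w) = C] =
  ((if alpha == 0
    then (\prod_(1 <= i < #|C|) (alpha + i%:R * d)) /
         (\prod_(1 <= i < n) (alpha + i%:R))
    else d ^+ #|C| / rising_factorial alpha n *
         rising_factorial (alpha / d) #|C|) *
   \prod_(c in C) rising_factorial (1 - d) (#|c| - 1))%:E.

Proof.
move=> d01 ad n1 indv lawv z1 ci cp C pC.
have [/eqP cC tC C0] := and3P pC.
pose s (c : {set 'I_n}) := #|c|.-1.+1.
have sE c : c \in C -> s c = #|c|.
  move=> cinC; rewrite /s prednK// card_gt0; apply/negP => /eqP c0.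
  by rewrite -c0 cinC in C0.
have bC i : finset.pblock C i \in C by rewrite pblock_mem// cC inE.
have inb i : i \in finset.pblock C i by rewrite mem_pblock cC inE.
pose A M (g : {ffun {set 'I_n} -> 'I_M.+1}) :=
  \bigcap_i z i @^-1` [set (g (finset.pblock C i) : nat)].
have mA M g : measurable (@A M g).
  apply: fin_bigcap_measurable => // i _.
  by rewrite -[X in measurable X]setTI; exact: measurable_funPT.
have PA M g : labellings 0 C g ->
    P (@A M g) = (label_weight s (stick_weight alpha d) 0 C g)%:E.
  move=> Lg; have /labellingsP[g0 _ _] := Lg.
  rewrite (prob_stick_labels ci cp); last by move=> i; exact: g0.
  rewrite /label_weight -(expectation_stick_monomial d01 ad indv lawv).
  apply: eq_integral => w _; congr EFin.
  rewrite (prod_blocks (fun c => stick_breaking (fun i => v i : T -> R) (g c) w) pC).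
  rewrite -(stick_product_labels s (fun i => v i w) (fun i => 1 - v i w) Lg).
  by apply: eq_bigr => c cinC; rewrite sE.
(* With labels bounded by [M], the event is a finite disjoint union over the injective labellings of
   the blocks; its probability is the truncated sum. *)
pose E M := [set w | induced_partition (fun i => z i w) = C /\
                     forall i, (z i w <= M)%N].
have EA M : E M = \bigcup_(g in [set` labellings 0 C]) @A M g.
  apply/seteqP; split => w.
    move=> [/eqP/(induced_partitionP _ pC) zC zM].
    (* Each block receives the common value of [z] on it, read off at an arbitrary element. *)
    pose g : {ffun {set 'I_n} -> 'I_M.+1} := [ffun c =>
      if c \in C then inord (if [pick i in c] is Some i then z i w else 0%N)
      else ord0].
    have gE i : g (finset.pblock C i) = z i w :> nat.
      rewrite ffunE bC; case: pickP => [i' ii'|/(_ i)]; last by rewrite inb.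
      rewrite inordK ?ltnS//; apply/eqP; rewrite zC eq_sym.
      by rewrite eq_pblock// cC inE.
    exists g => /=; last by move=> i _ /=.
    apply/labellingsP; split.
    - move=> c cinC; have : c != finset.set0 by apply: contraNneq C0 => <-.
      move=> /set0Pn[i ic]; have := gE i.
      by rewrite (def_pblock tC cinC ic) => ->; exact: z1.
    - by move=> c /negbTE cC'; rewrite ffunE cC'.
    - move=> c c' cinC c'inC gcc'.
      have /set0Pn[i ic] : c != finset.set0 by apply: contraNneq C0 => <-.
      have /set0Pn[i' ic'] : c' != finset.set0 by apply: contraNneq C0 => <-.
      rewrite -(def_pblock tC cinC ic) -(def_pblock tC c'inC ic').
      apply/eqP; rewrite -zC -!gE (def_pblock tC cinC ic).
      by rewrite (def_pblock tC c'inC ic') gcc'.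
  move=> [g /labellingsP[g0 _ ginj] Ag].
  have zE i : z i w = g (finset.pblock C i) by exact: Ag.
  split; last by move=> i; rewrite zE -ltnS ltn_ord.
  apply/eqP/(induced_partitionP _ pC) => i i'; rewrite !zE.
  by apply/eqP/eqP => [/val_inj /ginj ->|->].
have mE M : measurable (E M).
  by rewrite EA; apply: fin_bigcup_measurable.
have PE M : P (E M) = (labelled_sum s (stick_weight alpha d) M 0 C)%:E.
  rewrite EA measure_fin_bigcup//; last first.
    move=> g g' /labellingsP[_ gD _] /labellingsP[_ g'D _] [w [Ag Ag']].
    apply/ffunP => c; have [cinC|cC'] := boolP (c \in C); last by rewrite gD ?g'D.
    have /set0Pn[i ic] : c != finset.set0 by apply: contraNneq C0 => <-.
    apply: val_inj; rewrite /= -(def_pblock tC cinC ic).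
    by rewrite -(Ag i I) -(Ag' i I).
  rewrite -(@bigfs _ _ _ _ (index_enum _)) ?index_enum_uniq//; last first.
    by move=> g _; rewrite mem_index_enum.
  rewrite /labelled_sum -sumEFin; apply: eq_bigr => g Lg.
  exact: PA.
have UE : \bigcup_M E M = [set w | induced_partition (fun i => z i w) = C].
  apply/seteqP; split => w; first by move=> [M _ []].
  move=> wC; exists (\max_i z i w) => //; split => // i.
  exact: leq_bigmax.
(* The events [E M] increase to the full event, so their probabilities converge by continuity from
   below; the limit is then identified through [labelled_sum_cvg]. *)
have cvgP : (P \o E) @ \oo --> P [set w | induced_partition (fun i => z i w) = C].
  rewrite -UE; apply: nondecreasing_cvg_mu => //.
    exact: bigcup_measurable.
  move=> M M' MM'; apply/subsetPset => w [wC wM]; split => // i.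
  exact: leq_trans (wM i) MM'.
rewrite -(eppf_formula d01 ad n1 pC).
apply: (cvg_unique _ cvgP) => //.
rewrite (_ : P \o E = EFin \o (fun M => labelled_sum s (stick_weight alpha d) M 0 C)).
  apply: cvg_EFin; first exact: nearW.
  exact: labelled_sum_cvg.
by apply/funext => M /=; rewrite PE.
Qed.
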